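(* There exist absolute constants $c_1>0$ and $c_2>0$ (and a threshold $N$) such that for every finite set $A \subset \mathbb{R}$ with $|A| \geq N$ and $|A+A| \leq |A|^{1+c_1}$, we have $|AAAA| \geq |A|^{2+c_2}$.
   Context: For finite $A \subset \mathbb{R}$, $A+A := \{a+b : a,b \in A\}$ and $AAAA := \{a_1a_2a_3a_4 : a_1,\dots,a_4 \in A\}$. The phrase ''for all sufficiently large finite sets'' in the paper is expressed here by the threshold $N$ on $|A|$. *)

(* Defs.v *)
From mathcomp Require Import all_boot all_order all_algebra finmap.
From mathcomp Require Import reals exp.

Set Implicit Arguments.
Unset Strict Implicit.
Unset Printing Implicit Defensive.

Local Open Scope fset_scope.
Local Open Scope ring_scope.

Definition sumset (R : realType) (A : {fset R}) : {fset R} :=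
  [fset a + b | a in A, b in A].

(* [A `*` A `*` A `*` A] associates to the left: [q] is [(((a1, a2), a3), a4)]. *)
Definition prodset4 (R : realType) (A : {fset R}) : {fset R} :=
  [fset q.1.1.1 * q.1.1.2 * q.1.2 * q.2 | q in A `*` A `*` A `*` A].

(* Main.v *)
(* Restrict to a set [B] of positive elements, with [m] elements, and write [K] for
   the doubling constant [|B + B| / m].  Two consecutive applications of the
   pigeonhole principle to the gaps of [B] give [h], [g > 0] and a subset [D] with
   about [m / K^8] elements such that [x], [x + h], [x + g], [x + g + h] are in [B]
   for every [x] in [D], and the elements of [D] are pairwise at distance at least
   [h] and [g].  As [F x = (x + h) / x] is decreasing and [F x / F (x + g)] is
   decreasing too, the products [a * F (x + g) * F y / F (y + g)] with [a < x < y]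
   in [D] are pairwise distinct, so [BBBB / BBB] has about [m^3] elements.  On the
   other hand Solymosi's argument gives about [m^2] elements in [X = BB], and if
   [XX = BBBB] had not much more than [m^2] elements then Plunnecke's inequality
   would bound [XX / XX], hence [BBBB / BBB], by not much more than [m^2]. *)
Require Import Defs.
From mathcomp Require Import all_boot all_order all_algebra finmap.
From mathcomp Require Import reals exp.
From mathcomp Require Import zify ring lra.

Set Implicit Arguments.
Unset Strict Implicit.
Unset Printing Implicit Defensive.

Import Order.TTheory GRing.Theory Num.Theory.

Local Open Scope fset_scope.
Local Open Scope ring_scope.

(** * Counting *)

Section Counting.
Local Open Scope nat_scope.

Lemma leq_card_in_fset (T T' : choiceType) (f : T -> T') (A : {fset T})
    (B : {fset T'}) :
  {in A, forall x, f x \in B} -> {in A &, injective f} -> #|` A| <= #|` B|.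
Proof.
move=> fAB f_inj; rewrite -(card_in_imfset imfset_key f_inj).
by apply: fsubset_leq_card; apply/fsubsetP => _ /imfsetP[x xA ->]; exact: fAB.
Qed.

Lemma sum_fset_const (T : choiceType) (A : {fset T}) (k : nat) :
  \sum_(x <- A) k = #|` A| * k.
Proof. by rewrite big_const_seq count_predT iter_addn_0 mulnC. Qed.

Lemma cardfsM (T T' : choiceType) (A : {fset T}) (B : {fset T'}) :
  #|` A `*` B| = #|` A| * #|` B|.
Proof.
rewrite card_fset_sum1 big_imfset2 /=; last by move=> [? ?] [? ?] _ _ /= [-> ->].
by rewrite !sum_fset_const muln1.
Qed.

Definition fiber (T T' : choiceType) (f : T -> T') (A : {fset T}) (y : T') :=
  [fset x in A | f x == y].

Lemma in_fiber (T T' : choiceType) (f : T -> T') (A : {fset T}) (y : T') x :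
  (x \in fiber f A y) = (x \in A) && (f x == y).
Proof. by rewrite !inE. Qed.

Lemma card_fiber_sum (T T' : choiceType) (f : T -> T') (A : {fset T})
    (C : {fset T'}) :
  {in A, forall x, f x \in C} -> #|` A| = \sum_(y <- C) #|` fiber f A y|.
Proof.
move=> fAC; rewrite card_fset_sum1.
transitivity (\sum_(x <- A) \sum_(y <- C | f x == y) 1).
  apply: eq_big_seq => x /fAC fxC.
  rewrite -big_filter (perm_big [:: f x]) ?big_seq1 //.
  apply: uniq_perm; rewrite ?filter_uniq // => y.
  by rewrite mem_filter inE; case: eqVneq => [<-|].
rewrite (exchange_big_dep xpredT) //=; apply: eq_bigr => y _.
by rewrite card_fset_sum1 big_fset_condE /=; apply: eq_fbig => // x; rewrite !inE.
Qed.

(** If every fiber were too small, summing over [C] would give [|C| |A| + |C| <= |C| |A|],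
    impossible since [C] is nonempty. *)
Lemma pigeonhole_fiber (T T' : choiceType) (f : T -> T') (A : {fset T})
    (C : {fset T'}) :
  {in A, forall x, f x \in C} -> 0 < #|` A| ->
  exists2 y, y \in C & #|` A| <= #|` C| * #|` fiber f A y|.
Proof.
move=> fAC A0.
have [/hasP[y yC le_y]|/hasPn no] :=
  boolP (has (fun y => #|` A| <= #|` C| * #|` fiber f A y|) C); first by exists y.
have C0 : 0 < #|` C|.
  by move: A0; rewrite !cardfs_gt0 => /fset0Pn[x /fAC ?]; apply/fset0Pn; exists (f x).
suff : #|` C| * #|` A| + #|` C| <= #|` C| * #|` A| by lia.
rewrite -[X in _ <= X]sum_fset_const {1}(card_fiber_sum fAC) big_distrr /=.
rewrite [X in _ + X]card_fset_sum1 -big_split /=.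
rewrite [X in X <= _]big_seq [X in _ <= X]big_seq; apply: leq_sum => y /no.
by rewrite -ltnNge addn1.
Qed.

(** The left side counts the pairs [(x, t)] with [t] in [F x]; disjointness makes the projection to
    [t] injective on them. *)
Lemma leq_sum_card_disjoint (T T' : choiceType) (F : T -> {fset T'})
    (A : {fset T}) (S : {fset T'}) :
  {in A, forall x, F x `<=` S} ->
  {in A &, forall x y t, t \in F x -> t \in F y -> x = y} ->
  \sum_(x <- A) #|` F x| <= #|` S|.
Proof.
move=> FS Fdisj; pose Z := [fset p in A `*` S | p.2 \in F p.1].
have ZA : {in Z, forall p, p.1 \in A} by move=> p; rewrite !inE => /andP[/andP[]].
apply: (@leq_trans #|` Z|).
  rewrite (card_fiber_sum ZA) [X in X <= _]big_seq [X in _ <= X]big_seq.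
  apply: leq_sum => x xA; apply: (@leq_card_in_fset _ _ (fun t => (x, t))).
    by move=> t tF; rewrite in_fiber !inE /= xA tF eqxx (fsubsetP (FS x xA)).
  by move=> t u _ _ [].
apply: (@leq_card_in_fset _ _ snd); first by move=> p; rewrite !inE => /andP[/andP[]].
move=> [x t] [y u]; rewrite !inE /= => /andP[/andP[xA _] tx] /andP[/andP[yA _] uy] tu.
by congr pair => //; apply: (Fdisj x y xA yA t); rewrite // tu.
Qed.

(** After doubling, both sides are double sums over [C], compared termwise by
    [2 r_i r_j <= r_i ^ 2 + r_j ^ 2]. *)
Lemma cauchy_schwarz_card (T : choiceType) (C : {fset T}) (r : T -> nat) :
  (\sum_(y <- C) r y) ^ 2 <= #|` C| * \sum_(y <- C) r y ^ 2.
Proof.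
rewrite -(leq_pmul2l (ltn0Sn 1)) -mulnn big_distrlr /= big_distrr /=.
apply: (@leq_trans (\sum_(i <- C) \sum_(j <- C) (r i ^ 2 + r j ^ 2))).
  by apply: leq_sum => i _; rewrite big_distrr; apply: leq_sum => j _; exact: nat_Cauchy.
rewrite (eq_bigr (fun i => #|` C| * r i ^ 2 + \sum_(j <- C) r j ^ 2)); last first.
  by move=> i _; rewrite big_split /= sum_fset_const.
by rewrite big_split /= -big_distrr /= sum_fset_const; lia.
Qed.

End Counting.

(** * Popular gaps *)

Section Successor.
Local Open Scope order_scope.

(* The least element of [A] above [x], or the junk value [x] when there is none. *)
Definition next_in (d : Order.disp_t) (T : orderType d) (A : {fset T}) (x : T) : T :=
  head x (sort <=%O [seq y <- A | x < y]).

(** Because of the junk value of [next_in], this is [A] without its greatest element. *)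
Definition nonmax (d : Order.disp_t) (T : orderType d) (A : {fset T}) :=
  [fset x in A | x < next_in A x].

Lemma next_in_le d (T : orderType d) (A : {fset T}) (x y : T) :
  y \in A -> x < y -> next_in A x <= y.
Proof.
move=> yA xy; rewrite /next_in; set s := sort _ _.
have : y \in s by rewrite mem_sort mem_filter xy.
have : sorted <=%O s by exact: sort_le_sorted.
case: s => //= z s; rewrite (path_sortedE le_trans) inE => /andP[/allP zs _].
by case/predU1P => [->//|/zs].
Qed.

Lemma next_in_spec d (T : orderType d) (A : {fset T}) (x : T) :
  (next_in A x = x /\ {in A, forall y, y <= x}) \/
  (next_in A x \in A /\ x < next_in A x).
Proof.
have [/hasP[y yA xy]|/hasPn no] := boolP (has (fun y => x < y) A).
  right; rewrite /next_in; set s := sort _ _.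
  have ys : y \in s by rewrite mem_sort mem_filter xy.
  have : all (fun y => (y \in A) && (x < y)) s.
    by apply/allP => z; rewrite mem_sort mem_filter andbC.
  by case: s ys => // z s _ /= /andP[/andP[]].
left; split=> [|y /no]; last by rewrite -leNgt.
by rewrite /next_in (eq_in_filter (a2 := pred0)) ?filter_pred0 // => y /no /negPf.
Qed.

Lemma next_in_mem d (T : orderType d) (A : {fset T}) (x : T) :
  x \in A -> next_in A x \in A.
Proof. by case: (next_in_spec A x) => [[->]|[]]. Qed.

Lemma card_nonmax d (T : orderType d) (A : {fset T}) :
  (#|` A| <= #|` nonmax A|.+1)%N.
Proof.
rewrite -addn1 -leq_subLR -cardfsDS; last by apply/fsubsetP => x; rewrite !inE => /andP[].
rewrite -(cardfs1 tt); apply: (@leq_card_in_fset _ _ (fun=> tt)) => [x _|x y].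
  by rewrite inE.
have max z : z \in (A `\` nonmax A)%fset -> z \in A /\ {in A, forall y, y <= z}.
  rewrite !inE => /andP[+ zA]; rewrite zA /=.
  by case: (next_in_spec A z) => [[_ ?]|[_ ->]].
by move=> /max[xA xm] /max[yA ym] _; apply/le_anti; rewrite xm // ym.
Qed.

End Successor.

(* For most [x, b] in [B] the sums [x + b] and [next_in B x + b] are separated by at
   most [4 * K] elements of [B + B].  Such a pair of sums is one of few, so one pair
   arises from many [x], all of which have the same gap to their successor. *)
Lemma popular_gap (R : realType) (B : {fset R}) (K : nat) :
  (4 <= #|` B|)%N -> (#|` sumset B| <= K * #|` B|)%N ->
  exists (h : R) (B' : {fset R}), [/\ 0 < h, B' `<=` B,
    {in B', forall x, x + h \in B},
    {in B' &, forall x y, x < y -> x + h <= y} &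
    (#|` B| <= 10 * K ^ 2 * #|` B'|)%N].
Proof.
set m := #|` B|; set S := sumset B => m4 SK.
have memS x y : x \in B -> y \in B -> x + y \in S by move=> *; apply: in_imfset2.
have K0 : (0 < K)%N.
  rewrite lt0n; apply: contraTneq m4 => K0; move: SK; rewrite K0 leqNgt cardfs_gt0.
  rewrite /m; have [->|/fset0Pn[x xB]] := eqVneq B fset0; first by rewrite cardfs0.
  by move=> /negP[]; apply/fset0Pn; exists (x + x); exact: memS.
pose gap (p : R * R) := [fset t in S | p.1 + p.2 < t <= next_in B p.1 + p.2].
(* For fixed [b], the half-open intervals between consecutive translates are disjoint. *)
have gap_sum (b : R) : (\sum_(x <- nonmax B) #|` gap (x, b)| <= #|` S|)%N.
  apply: leq_sum_card_disjoint => [x _|x y].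
    by apply/fsubsetP => t; rewrite inE => /andP[].
  rewrite !inE => /andP[xB _] /andP[yB _] t.
  rewrite !inE /= => /andP[_ /andP[xt tx]] /andP[_ /andP[yt ty]].
  have [xy|yx|//] := ltgtP x y.
    by have := next_in_le yB xy; lra.
  by have := next_in_le xB yx; lra.
pose W := nonmax B `*` B.
pose Bd := [fset p in W | (4 * K < #|` gap p|)%N].
have BdW : Bd `<=` W by apply/fsubsetP => p; rewrite inE => /andP[].
have cBd : (#|` Bd| * (4 * K) <= m * #|` S|)%N.
  rewrite -sum_fset_const -sum_fset_const.
  apply: (@leq_trans (\sum_(p <- W) #|` gap p|)); last first.
    rewrite /W big_imfset2 /=; last by move=> [? ?] [? ?] _ _ /= [-> ->].
    by rewrite exchange_big /=; apply: leq_sum => b _; exact: gap_sum.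
  rewrite -big_fset_condE /= big_mkcond /=; apply: leq_sum => p _.
  by case: ifP => // /ltnW.
pose G := W `\` Bd.
(* By [cBd] and [SK], at most [m ^ 2 / 4] of the at least [m (m - 1)] pairs in [W] are bad; as
   [4 <= m], at least [m ^ 2 / 2] remain. *)
have cG : (m ^ 2 <= 2 * #|` G|)%N.
  have cW : (m * (m - 1) <= #|` W|)%N.
    by rewrite cardfsM mulnC leq_mul // leq_subLR add1n card_nonmax.
  have := cardfsDS BdW; rewrite -/G.
  have : (#|` Bd| * 4 <= m ^ 2)%N.
    rewrite -(leq_pmul2r K0) -mulnA (leq_trans cBd) // -mulnn -mulnA leq_mul2l.
    by rewrite mulnC SK orbT.
  nia.
have gapG p : p \in G -> (#|` gap p| <= 4 * K)%N.
  rewrite in_fsetD => /andP[pBd pW]; rewrite leqNgt; apply: contra pBd => lt_p.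
  by move: pW; rewrite !inE lt_p andbT.
(* The sum [u] and the gap size [i] pin down the next sum: it is the [i]-th element of [S] above
   [u]. On [G] the bound [gapG] makes [inord] faithful. *)
pose f (p : R * R) := (p.1 + p.2, inord #|` gap p| : 'I_(4 * K).+1).
have fG : {in G, forall p, f p \in S `*` [fset i in 'I_(4 * K).+1]}.
  move=> p; rewrite in_fsetD !in_fsetM => /andP[_ /andP[+ yB]].
  by rewrite !inE andbT => /andP[xB _]; exact: memS.
have [|[u i] _ cfib] := pigeonhole_fiber fG; first by lia.
set Q := fiber _ _ _ in cfib.
have QP p : p \in Q -> [/\ p.1 \in B, p.2 \in B, p.1 + p.2 = u & #|` gap p| = i].
  rewrite in_fiber => /andP[pG /eqP[<- <-]].
  rewrite inordK ?ltnS ?gapG //.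
  move: pG; rewrite in_fsetD in_fsetM => /andP[_ /andP[+ ->]].
  by rewrite inE => /andP[->].
(* From [m ^ 2 / 2 <= |S| (4 K + 1) |Q|], [|S| <= K m] and [2 K (4 K + 1) <= 10 K ^ 2]. *)
have cQ : (m <= 10 * K ^ 2 * #|` Q|)%N.
  move: cfib; rewrite cardfsM card_finset card_ord => cfib.
  have : (m * m <= 2 * (K * m * (4 * K).+1 * #|` Q|))%N.
    rewrite mulnn (leq_trans cG) // leq_mul2l /= (leq_trans cfib) //.
    by rewrite leq_mul2r leq_mul2r SK !orbT.
  have m0 : (0 < m)%N by lia.
  move=> H; rewrite -(leq_pmul2l m0) (leq_trans H) //.
  rewrite -mulnn; nia.
have [p0 p0Q] : exists p, p \in Q.
  apply/fset0Pn; rewrite -cardfs_gt0.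
  by case: (#|` Q|) cQ => //; rewrite muln0; lia.
(* Both gaps start at [u]; if one ended earlier it would be strictly included in the other, yet both
   have [i] elements. *)
have top p q : p \in Q -> q \in Q -> next_in B p.1 + p.2 <= next_in B q.1 + q.2.
  move=> /QP[p1 p2 pu pi] /QP[q1 q2 qu qi]; rewrite leNgt; apply/negP => lt_qp.
  have : gap q `<` gap p.
    rewrite fproperE; apply/andP; split.
      apply/fsubsetP => t; rewrite !inE => /andP[-> /andP[]]; rewrite pu qu => -> tq.
      exact: le_trans tq (ltW lt_qp).
    apply/negP => /fsubsetP /(_ (next_in B p.1 + p.2)).
    rewrite !inE lexx memS ?next_in_mem //= andbT leNgt lt_qp !andbF pu => H.
    suff : u < next_in B p.1 + p.2 by move=> /H.
    by apply: le_lt_trans lt_qp; rewrite -qu; case: (next_in_spec B q.1) => [[->]|[]] *; lra.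
  by move=> /fproper_ltn_card; rewrite pi qi ltnn.
exists (next_in B p0.1 - p0.1), [fset p.1 | p in Q].
have gapE p : p \in Q -> p.1 + (next_in B p0.1 - p0.1) = next_in B p.1.
  move=> pQ; have := top p p0 pQ p0Q; have := top p0 p p0Q pQ.
  have [_ _ + _] := QP _ pQ; have [_ _ + _] := QP _ p0Q; lra.
split.
- rewrite subr_gt0; move: p0Q; rewrite in_fiber !inE.
  by case/andP => /andP[_ /andP[/andP[]]].
- by apply/fsubsetP => _ /imfsetP[p /QP[p1 _ _ _] ->].
- by move=> _ /imfsetP[p pQ ->]; rewrite gapE // next_in_mem //; case/QP: pQ.
- move=> _ _ /imfsetP[p pQ ->] /imfsetP[q qQ ->] pq.
  by rewrite gapE //; apply: next_in_le => //; case/QP: qQ.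
(* In [Q] the first coordinate determines the second, as they sum to [u]; projecting loses
   nothing. *)
- rewrite card_in_imfset // => -[x b] [y c] /QP[_ _ /= xu _] /QP[_ _ /= yu _] xy.
  by congr pair => //; apply: (addrI x); rewrite xu xy yu.
Qed.

(** * Squeezing *)

Definition mulset (F : fieldType) (X Y : {fset F}) : {fset F} :=
  [fset x * y | x in X, y in Y].

Definition divset (F : fieldType) (X Y : {fset F}) : {fset F} :=
  [fset x / y | x in X, y in Y].

Lemma mulset_mem (F : fieldType) (X Y : {fset F}) x y :
  x \in X -> y \in Y -> x * y \in mulset X Y.
Proof. by move=> *; apply: in_imfset2. Qed.

Lemma divset_mem (F : fieldType) (X Y : {fset F}) x y :
  x \in X -> y \in Y -> x / y \in divset X Y.
Proof. by move=> *; apply: in_imfset2. Qed.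

Lemma fset_split (F : realFieldType) (A : {fset F}) (k : nat) :
  (k <= #|` A|)%N ->
  exists A1 A2 : {fset F}, [/\ A1 `<=` A, A2 `<=` A,
    #|` A1| = k, #|` A2| = (#|` A| - k)%N &
    {in A1 & A2, forall x y, x < y}].
Proof.
move=> kA; pose s := sort <=%O A.
have us : uniq s by rewrite sort_uniq fset_uniq.
have ss : size s = #|` A| by rewrite size_sort.
have memA x : x \in s -> x \in A by rewrite mem_sort.
exists [fset x in take k s]%fset, [fset x in drop k s]%fset; split.
- by apply/fsubsetP => x; rewrite inE => /mem_take; exact: memA.
- by apply/fsubsetP => x; rewrite inE => /mem_drop; exact: memA.
- by rewrite card_fseq undup_id ?take_uniq // size_takel // ss.
- by rewrite card_fseq undup_id ?drop_uniq // size_drop ss.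
have : sorted <%O s by rewrite lt_sorted_uniq_le us sort_le_sorted.
rewrite lt_sorted_pairwise -{1}(cat_take_drop k s) pairwise_cat.
by move=> /and3P[/allrelP H _ _] x y; rewrite !inE => /H; apply.
Qed.

(* With [F z = (z + h) / z], this is [F (x + g) * F y / F (y + g)]. *)
Definition squeeze (F : fieldType) (g h x y : F) : F :=
  (x + g + h) / (x + g) * ((y + h) / y) * ((y + g) / (y + g + h)).

(** From this factored form the lower bound and the monotonicity in [y] can be read off. *)
Lemma squeezeE (F : realFieldType) (g h x y : F) :
  0 < g -> 0 < h -> 0 < x -> 0 < y ->
  squeeze g h x y = (1 + h / (x + g)) * (1 + g * h / (y * (y + g + h))).
Proof.
move=> g0 h0 x0 y0; rewrite /squeeze; field.
by rewrite !lt0r_neq0 ?addr_gt0.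
Qed.

Lemma squeeze_gt (F : realFieldType) (g h x y : F) :
  0 < g -> 0 < h -> 0 < x -> 0 < y -> 1 + h / (x + g) < squeeze g h x y.
Proof.
move=> g0 h0 x0 y0.
by rewrite squeezeE // ltr_pMr ?ltrDl ?(addr_gt0, divr_gt0, mulr_gt0).
Qed.

Lemma squeeze_decreasing (F : realFieldType) (g h x y z : F) :
  0 < g -> 0 < h -> 0 < x -> 0 < y -> y < z ->
  squeeze g h x z < squeeze g h x y.
Proof.
move=> g0 h0 x0 y0 yz; have z0 := lt_trans y0 yz.
rewrite !squeezeE // ltr_pM2l ?(addr_gt0, divr_gt0) // ltrD2l ltr_pM2l ?mulr_gt0 //.
by rewrite ltf_pV2 ?posrE ?(addr_gt0, mulr_gt0) // ltr_pM ?ltrD2r ?addr_ge0 ?ltW.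
Qed.

(** At [y = x] the three fractions collapse to [(x + h) / x], and increasing [y] only decreases the
    value. *)
Lemma squeeze_lt (F : realFieldType) (g h x y : F) :
  0 < g -> 0 < h -> 0 < x -> x < y -> squeeze g h x y < 1 + h / x.
Proof.
move=> g0 h0 x0 xy; apply: lt_le_trans (squeeze_decreasing g0 h0 x0 x0 xy) _.
rewrite le_eqVlt; apply/orP; left; apply/eqP; rewrite /squeeze; field.
by rewrite !lt0r_neq0 ?addr_gt0.
Qed.

(* [a * squeeze x y] lies strictly between [a] and [a + h], which determines [a];
   [squeeze x y] lies strictly between [1 + h / (x + g)] and [1 + h / x], which
   determines [x]. *)
Lemma squeeze_inj (F : realFieldType) (g h : F) (D : {fset F}) a x y a' x' y' :
  0 < g -> 0 < h -> {in D, forall x, 0 < x} ->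
  {in D &, forall x y, x < y -> x + h <= y} ->
  {in D &, forall x y, x < y -> x + g <= y} ->
  [/\ a \in D, x \in D, y \in D, a < x & x < y] ->
  [/\ a' \in D, x' \in D, y' \in D, a' < x' & x' < y'] ->
  a * squeeze g h x y = a' * squeeze g h x' y' -> [/\ a = a', x = x' & y = y'].
Proof.
move=> g0 h0 D0 Dh Dg.
have lt_a a1 x1 y1 a2 x2 y2 :
    [/\ a1 \in D, x1 \in D, y1 \in D, a1 < x1 & x1 < y1] ->
    [/\ a2 \in D, x2 \in D, y2 \in D, a2 < x2 & x2 < y2] -> a1 < a2 ->
    a1 * squeeze g h x1 y1 < a2 * squeeze g h x2 y2.
  move=> [/[dup] a1D /D0 a1p /D0 x1p y1D ax1 xy1].
  move=> [/[dup] a2D /D0 a2p /D0 x2p /D0 y2p ax2 xy2] /Dh le12.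
  apply: (@lt_trans _ _ a2).
    apply: lt_le_trans (le12 _ _) => //.
    apply: (@lt_le_trans _ _ (a1 * (1 + h / x1))).
      by rewrite ltr_pM2l // squeeze_lt.
    rewrite mulrDr mulr1 lerD2l mulrCA ler_piMr ?(ltW h0) //.
    by rewrite ler_pdivrMr // mul1r ltW.
  rewrite ltr_pMr //; apply: lt_trans (squeeze_gt g0 h0 x2p y2p).
  by rewrite ltrDl divr_gt0 // addr_gt0.
have lt_x x1 y1 x2 y2 :
    [/\ x1 \in D, y1 \in D & x1 < y1] -> [/\ x2 \in D, y2 \in D & x2 < y2] ->
    x1 < x2 -> squeeze g h x2 y2 < squeeze g h x1 y1.
  move=> [/[dup] x1D /D0 x1p /D0 y1p xy1] [/[dup] x2D /D0 x2p y2D xy2] /Dg le12.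
  apply: lt_trans (squeeze_gt g0 h0 x1p y1p).
  apply: lt_le_trans (squeeze_lt g0 h0 x2p xy2) _.
  by rewrite lerD2l ler_pM2l // lef_pV2 ?posrE ?addr_gt0 // le12.
move=> axy axy' eqq.
have ea : a = a'.
  case: (ltgtP a a') => // [/(lt_a _ _ _ _ _ _ axy axy')|/(lt_a _ _ _ _ _ _ axy' axy)].
    by rewrite eqq ltxx.
  by rewrite eqq ltxx.
subst a'; move: axy axy' eqq => [/D0 a0 xD yD _ xy] [_ xD' yD' _ xy'].
move/(mulfI (lt0r_neq0 a0)) => eqq.
have ex : x = x'.
  case: (ltgtP x x') => // /lt_x H; exfalso.
    by move: (H y y' (And3 xD yD xy) (And3 xD' yD' xy')); rewrite eqq ltxx.
  by move: (H y' y (And3 xD' yD' xy') (And3 xD yD xy)); rewrite eqq ltxx.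
subst x'; split => //.
have [x0 y0 y0'] := And3 (D0 _ xD) (D0 _ yD) (D0 _ yD').
case: (ltgtP y y') => // [/(squeeze_decreasing g0 h0 x0 y0)|
                          /(squeeze_decreasing g0 h0 x0 y0')].
  by rewrite eqq ltxx.
by rewrite eqq ltxx.
Qed.

(** Three consecutive blocks of [D] provide [k ^ 3] triples [a < x < y], to which [squeeze_inj]
    applies. *)
Lemma leq_cube_quotient (F : realFieldType) (B D : {fset F}) (g h : F) (k : nat) :
  0 < g -> 0 < h -> {in B, forall x, 0 < x} -> D `<=` B ->
  {in D, forall x, [/\ x + g \in B, x + h \in B & x + g + h \in B]} ->
  {in D &, forall x y, x < y -> x + h <= y} ->
  {in D &, forall x y, x < y -> x + g <= y} ->
  (3 * k <= #|` D|)%N ->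
  (k ^ 3 <= #|` divset (mulset (mulset B B) (mulset B B))
                       (mulset (mulset B B) (mulset B B))|)%N.
Proof.
move=> g0 h0 B0 DB Dgh Dh Dg kD.
have [->|k0] := posnP k; first by rewrite exp0n.
have inB := fsubsetP DB.
have [|D1 [D' [D1D D'D c1 c' lt1]]] := @fset_split _ D k; first by lia.
have [|D2 [D3 [D2D' D3D' c2 c3 lt2]]] := @fset_split _ D' k; first by lia.
have {}c3 : (k <= #|` D3|)%N by lia.
have [D2D D3D] := (fsubset_trans D2D' D'D, fsubset_trans D3D' D'D).
have [b0 b0D] : exists b, b \in D by apply/fset0Pn; rewrite -cardfs_gt0; lia.
have b0B := inB _ b0D; have b00 := B0 _ b0B.
(* Dividing by a fixed [b0] gives the denominator its fourth factor, to match the four of the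
   numerator. *)
pose f (p : F * F * F) := p.1.1 * squeeze g h p.1.2 p.2 / b0.
apply: (@leq_trans #|` D1 `*` D2 `*` D3|).
  by rewrite !cardfsM c1 c2 !expnS expn0 muln1 mulnA leq_mul2l c3 orbT.
have pP p : p \in D1 `*` D2 `*` D3 ->
    [/\ p.1.1 \in D, p.1.2 \in D, p.2 \in D, p.1.1 < p.1.2 & p.1.2 < p.2].
  rewrite !inE => /andP[/andP[p1 p2] p3].
  split; [exact: (fsubsetP D1D)|exact: (fsubsetP D2D)|exact: (fsubsetP D3D)| |exact: lt2].
  by apply: lt1 => //; exact: (fsubsetP D2D').
apply: (@leq_card_in_fset _ _ f) => [[[a x] y] /pP /= [aD xD yD _ _]|].
  have [[xg xh xgh] [yg yh ygh]] := (Dgh x xD, Dgh y yD).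
  have -> : f (a, x, y) = (a * (x + g + h)) * ((y + h) * (y + g)) /
      ((b0 * (x + g)) * (y * (y + g + h))).
    rewrite /f /squeeze /=; field.
    by rewrite !lt0r_neq0 ?addr_gt0 // B0 ?inB.
  by apply: divset_mem; do 2 apply: mulset_mem => //; exact: inB.
move=> [[a x] y] [[a' x'] y'] /pP /= H /pP /= H'; rewrite /f /=.
move/(mulIf (invr_neq0 (lt0r_neq0 b00))).
by case/(squeeze_inj g0 h0 (fun x xD => B0 x (inB x xD)) Dh Dg H H') => -> -> ->.
Qed.

(** * Products of sets with few sums *)

(** When [f] is the product or the quotient of a pair, this expresses the multiplicative energy
    through representation counts. *)
Lemma card_collisions (T T' : choiceType) (f : T -> T') (A : {fset T})
    (C : {fset T'}) :
  {in A, forall x, f x \in C} ->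
  #|` [fset z in A `*` A | f z.1 == f z.2]| = (\sum_(y <- C) #|` fiber f A y| ^ 2)%N.
Proof.
move=> fAC; rewrite (@card_fiber_sum _ _ (fun z => f z.1) _ C); last first.
  by move=> z; rewrite !inE => /andP[/andP[/fAC]].
apply: eq_bigr => y _; rewrite -mulnn -cardfsM; congr #|` _|.
apply/fsetP => z; rewrite !inE; case: (z.1 \in A) => //=; case: (z.2 \in A) => //=.
  by case: (eqVneq (f z.1) y) => [->|]; rewrite ?andbT ?andbF // eq_sym.
by rewrite andbF.
Qed.

(* Solymosi: the vector sums of points on consecutive lines through the origin lie
   strictly between these lines, hence are pairwise distinct. *)
Lemma rich_slopes (R : realType) (B : {fset R}) (t : nat) :
  {in B, forall x, 0 < x} ->
  (#|` [fset l in divset B B |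
        (t <= #|` fiber (fun p => p.1 / p.2) (B `*` B) l|)%N]| * t ^ 2
     <= 2 * #|` sumset B| ^ 2)%N.
Proof.
move=> B0; pose P := fiber (fun p : R * R => p.1 / p.2) (B `*` B).
set L := [fset l in _ | _]; set S := sumset B.
have [->|/fset0Pn[l0 l0L]] := eqVneq L fset0; first by rewrite cardfs0.
have memS x y : x \in B -> y \in B -> x + y \in S by move=> *; apply: in_imfset2.
have LP l : l \in L -> 0 < l /\ (t <= #|` P l|)%N.
  rewrite inE => /andP[/imfset2P[x xB [y yB ->]] ->].
  by rewrite divr_gt0 ?B0.
have PP l p : p \in P l -> [/\ p.1 \in B, p.2 \in B, 0 < p.2 & p.1 = l * p.2].
  rewrite in_fiber inE => /andP[/andP[p1 p2] /eqP <-].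
  by rewrite divfK ?lt0r_neq0 ?B0.
(* Passing from [L] to [nonmax L] loses one line, worth [t ^ 2 <= |S| ^ 2]: hence the factor 2 in
   the statement. *)
have tS : (t <= #|` S|)%N.
  have [_ /leq_trans] := LP _ l0L; apply.
  have /imfset2P[x xB _] : l0 \in divset B B by move: l0L; rewrite inE => /andP[].
  apply: (@leq_card_in_fset _ _ (fun p => p.2 + x)) => [p /PP[_ p2 _ _]|].
    exact: memS.
  move=> [p1 p2] [q1 q2] /PP[_ _ _ /= ->] /PP[_ _ _ /= ->] /addIr ->.
  by [].
pose add (z : (R * R) * (R * R)) := (z.1.1 + z.2.1, z.1.2 + z.2.2).
pose F l := [fset add z | z in P l `*` P (next_in L l)].
have FP l u : u \in F l -> l \in nonmax L -> l * u.2 < u.1 < next_in L l * u.2.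
  move=> /imfsetP[z zP ->]; rewrite !inE => /andP[_ lt_l].
  move: zP; rewrite in_fsetM => /andP[/PP[_ _ z1 /= ->] /PP[_ _ z2 /= ->]].
  by rewrite !mulrDr ltrD2l ltrD2r !ltr_pM2r // lt_l.
have cF l : l \in nonmax L -> (t ^ 2 <= #|` F l|)%N.
  move=> lN; have [lL lt_l] : l \in L /\ l < next_in L l by move: lN; rewrite inE => /andP.
  rewrite card_in_imfset /=; last first.
    move=> [[p1 p2] [q1 q2]] [[p1' p2'] [q1' q2']]; rewrite !in_fsetM /=.
    move=> /andP[/PP[_ _ _ /= ->] /PP[_ _ _ /= ->]].
    move=> /andP[/PP[_ _ _ /= ->] /PP[_ _ _ /= ->]] [] e1 e2.
    (* Eliminating the second point from [e1] and [e2] determines the first, since the two slopes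
       differ. *)
    have : (next_in L l - l) * (p2 - p2') = 0.
      transitivity (next_in L l * (p2 + q2) - (l * p2 + next_in L l * q2) -
        (next_in L l * (p2' + q2') - (l * p2' + next_in L l * q2'))); first by ring.
      by rewrite e1 e2 subrr.
    move/eqP; rewrite mulf_eq0 subr_eq0 gt_eqF //= subr_eq0 => /eqP e.
    by move: e2; rewrite e => /addrI ->.
  rewrite cardfsM -mulnn leq_mul //; first by case: (LP l lL).
  by case: (LP (next_in L l)) => //; exact: next_in_mem.
have : (#|` nonmax L| * t ^ 2 <= #|` S| ^ 2)%N.
  rewrite -sum_fset_const -[X in (_ <= X)%N]mulnn -cardfsM.
  apply: (@leq_trans (\sum_(l <- nonmax L) #|` F l|)).
    by rewrite [X in (X <= _)%N]big_seq [X in (_ <= X)%N]big_seq; apply: leq_sum.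
  apply: leq_sum_card_disjoint => [l lN|l l' lN lN' u ul ul'].
    apply/fsubsetP => _ /imfsetP[z zP ->]; move: zP; rewrite in_fsetM.
    by move=> /andP[/PP[? ? _ _] /PP[? ? _ _]]; rewrite inE !memS.
  have u2 : 0 < u.2.
    case/imfsetP: ul => z zP ->; move: zP; rewrite in_fsetM.
    by move=> /andP[/PP[_ _ ? _] /PP[_ _ ? _]]; rewrite addr_gt0.
  have mem_L x : x \in nonmax L -> x \in L by rewrite inE => /andP[].
  have lt_F x y : x \in nonmax L -> y \in nonmax L -> u \in F x -> u \in F y ->
      x < y -> False.
    move=> xN yN /FP/(_ xN)/andP[_ ux] /FP/(_ yN)/andP[uy _] xy.
    have := next_in_le (mem_L _ yN) xy; rewrite -(ler_pM2r u2) => H.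
    by have := lt_le_trans (lt_trans uy ux) H; rewrite ltxx.
  by case: (ltgtP l l') => // /lt_F []; auto.
move=> cN; apply: leq_trans (leq_mul (card_nonmax L) (leqnn _)) _.
by rewrite mulSn mul2n -addnn leq_add // leq_exp2r.
Qed.

(** Dyadic decomposition: if [2 ^ j <= r l < 2 ^ (j + 1)] then [r l ^ 2 <= 4 (2 ^ j) ^ 2], and each
    of the [J] levels contributes at most [4 M]. *)
Lemma sum_sqr_richness (T : choiceType) (L : {fset T}) (r : T -> nat) (M J : nat) :
  {in L, forall l, (r l < 2 ^ J)%N} ->
  (forall t, #|` [fset l in L | (t <= r l)%N]| * t ^ 2 <= M)%N ->
  (\sum_(l <- L) r l ^ 2 <= 4 * J * M)%N.
Proof.
move=> rJ rM.
apply: (@leq_trans (\sum_(l <- L) \sum_(j < J | (2 ^ j <= r l)%N) 4 * (2 ^ j) ^ 2)%N).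
  rewrite [X in (X <= _)%N]big_seq [X in (_ <= X)%N]big_seq; apply: leq_sum => l lL.
  have [->//|r0] := posnP (r l).
  have /andP[lo hi] := trunc_log_bounds (isT : (1 < 2)%N) r0.
  have jJ : (trunc_log 2 (r l) < J)%N.
    by rewrite -(ltn_exp2l _ _ (isT : (1 < 2)%N)) (leq_ltn_trans lo) // rJ.
  rewrite (bigD1 (Ordinal jJ)) //=; apply: leq_trans (leq_addr _ _).
  by rewrite -[4%N]/(2 ^ 2)%N -expnMn -expnS leq_exp2r // ltnW.
rewrite (exchange_big_dep xpredT) //= -mulnA mulnCA -[J in (J * _)%N]card_ord -sum_nat_const.
apply: leq_sum => j _; rewrite big_fset_condE /= sum_fset_const mulnCA leq_mul2l /=.
exact: rM.
Qed.

(** Cauchy-Schwarz bounds [|B| ^ 4] by [|BB|] times the multiplicative energy, and [rich_slopes]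
    bounds that energy level by level. *)
Lemma solymosi (R : realType) (B : {fset R}) (J : nat) :
  {in B, forall x, 0 < x} -> (#|` B| < 2 ^ J)%N ->
  (#|` B| ^ 4 <= #|` mulset B B| * (8 * J * #|` sumset B| ^ 2))%N.
Proof.
move=> B0 BJ.
have memM : {in B `*` B, forall p, p.1 * p.2 \in mulset B B}.
  by move=> p; rewrite inE => /andP[*]; apply: mulset_mem.
have memD : {in B `*` B, forall p, p.1 / p.2 \in divset B B}.
  by move=> p; rewrite inE => /andP[*]; apply: divset_mem.
have -> : (#|` B| ^ 4 = #|` B `*` B| ^ 2)%N by rewrite cardfsM mulnn -expnM.
rewrite (card_fiber_sum memM).
apply: leq_trans (cauchy_schwarz_card _ _) _; rewrite leq_mul2l -(card_collisions memM).
apply/orP; right.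
pose E := [fset z in (B `*` B) `*` (B `*` B) | z.1.1 / z.1.2 == z.2.1 / z.2.2].
apply: (@leq_trans #|` E|).
  (* The equation [a b = c d] becomes [a / c = d / b], which turns product collisions into pairs of
     points on a common line. *)
  apply: (@leq_card_in_fset _ _ (fun z => ((z.1.1, z.2.1), (z.2.2, z.1.2)))).
    move=> [[a b] [c d]]; rewrite !inE /=.
    move=> /andP[/andP[/andP[aB bB] /andP[cB dB]] /eqP eq_m].
    rewrite aB bB cB dB /= eqr_div ?lt0r_neq0 ?B0 //; apply/eqP.
    by rewrite eq_m mulrC.
  by move=> [[a b] [c d]] [[a' b'] [c' d']] _ _ [-> -> -> ->].
rewrite (card_collisions memD).
have -> : (8 * J * #|` sumset B| ^ 2 = 4 * J * (2 * #|` sumset B| ^ 2))%N by lia.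
apply: sum_sqr_richness => [l _|t]; last exact: rich_slopes.
apply: leq_ltn_trans BJ; apply: (@leq_card_in_fset _ _ snd).
  by move=> p; rewrite in_fiber inE => /andP[/andP[]].
move=> [a b] [c d]; rewrite !in_fiber !inE /=.
move=> /andP[/andP[_ bB] /eqP <-] /andP[_ /eqP e] bd; move: e; rewrite -bd.
by move/(mulIf (invr_neq0 (lt0r_neq0 (B0 _ bB)))) => ->.
Qed.

(** * Plunnecke's inequality *)

Lemma mulsetA (F : fieldType) (X Y Z : {fset F}) :
  mulset X (mulset Y Z) = mulset (mulset X Y) Z.
Proof.
apply/fsetP => t; apply/imfset2P/imfset2P.
  move=> [x xX [_ /imfset2P[y yY [z zZ ->]] ->]].
  by exists (x * y); [exact: mulset_mem|exists z; rewrite ?mulrA].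
move=> [_ /imfset2P[x xX [y yY ->]] [z zZ ->]].
by exists x => //; exists (y * z); [exact: mulset_mem|rewrite mulrA].
Qed.

(** A minimizer of [w Y / |Y|] exists because the power set is finite; cross-multiplication keeps
    the result in [nat]. *)
Lemma fset_min_ratio (T : choiceType) (X : {fset T}) (w : {fset T} -> nat) :
  X != fset0 -> exists Z : {fset T}, [/\ Z `<=` X, Z != fset0 &
    forall Y : {fset T}, Y `<=` X -> Y != fset0 -> (w Z * #|` Y| <= w Y * #|` Z|)%N].
Proof.
move=> X0; have XX : X \in fpowerset X by rewrite fpowersetE.
pose P (Y : fpowerset X) := val Y != fset0.
pose q (Y : fpowerset X) : rat := (w (val Y))%:R / #|` val Y|%:R.
case: (@arg_minP _ _ _ [` XX] P q X0) => Z PZ minZ.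
exists (val Z); split=> // [|Y YX Y0]; first by rewrite -fpowersetE (valP Z).
have YP : Y \in fpowerset X by rewrite fpowersetE.
have := minZ [` YP] Y0; rewrite /q /=.
rewrite ler_pdivrMr ?ltr0n ?cardfs_gt0 // mulrAC ler_pdivlMr ?ltr0n ?cardfs_gt0 //.
by rewrite -!natrM ler_nat.
Qed.

(* Petridis: induction on [C].  Adding [c] to [C] adds to [ZXC] only multiples [t * c]
   with [t] outside [Zc * X], where [Zc] collects the [z] with [z * c] in [ZC]; the
   minimality of [Z] bounds [Zc * X] from below. *)
Lemma petridis (F : fieldType) (X Z C : {fset F}) :
  0 \notin C ->
  (forall Y, Y `<=` Z -> (#|` mulset Z X| * #|` Y| <= #|` mulset Y X| * #|` Z|)%N) ->
  (#|` mulset (mulset Z X) C| * #|` Z| <= #|` mulset Z X| * #|` mulset Z C|)%N.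
Proof.
move=> + minZ; elim/fset1U_rect: C => [_|c C cC IH].
  suff -> : mulset (mulset Z X) fset0 = fset0 by rewrite cardfs0.
  by apply/fsetP => t; rewrite inE; apply/negP => /imfset2P[x _ []].
rewrite in_fset1U negb_or => /andP[c0 /IH{}IH].
have cI : injective ( *%R^~ c) by apply: mulIf; rewrite eq_sym.
pose Zc := [fset z in Z | z * c \in mulset Z C].
have ZcZ : Zc `<=` Z by apply/fsubsetP => z; rewrite inE => /andP[].
(* If [z c = z' d'] with [d'] in [C], then [(z x) c = (z' x) d'] is already in [ZXC]; so [Zc * X]
   contributes nothing new. *)
have upper : (#|` mulset (mulset Z X) (c |` C)| + #|` mulset Zc X| <=
    #|` mulset (mulset Z X) C| + #|` mulset Z X|)%N.
  have sub : mulset Zc X `<=` mulset Z X.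
    apply/fsubsetP => _ /imfset2P[z /(fsubsetP ZcZ) zZ [x xX ->]].
    exact: mulset_mem.
  pose U := [fset t * c | t in mulset Z X `\` mulset Zc X].
  have cU : (#|` U| + #|` mulset Zc X| = #|` mulset Z X|)%N.
    by rewrite card_imfset //= cardfsDS // subnK ?fsubset_leq_card.
  rewrite -cU addnA leq_add2r.
  apply: leq_trans (_ : (#|` mulset (mulset Z X) C `|` U| <= _)%N).
    apply: fsubset_leq_card; apply/fsubsetP => _ /imfset2P[t tZX [d + ->]].
    rewrite in_fset1U => /predU1P[->|dC]; last by rewrite in_fsetU mulset_mem.
    have [/imfset2P[z zZc [x xX ->]]|tZc] := boolP (t \in mulset Zc X).
      move: zZc; rewrite !inE => /= /andP[_ /imfset2P[z' z'Z [d' d'C e]]].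
      by rewrite mulrAC e mulrAC mulset_mem ?mulset_mem.
    by rewrite in_fsetU; apply/orP; right; apply: in_imfset; rewrite /= in_fsetD tZc.
  by rewrite -cardfsUI leq_addr.
(* For [z] outside [Zc] the product [z c] is not in [ZC], so each such [z] adds a new element. *)
have lower : (#|` mulset Z C| + #|` Z| <= #|` mulset Z (c |` C)| + #|` Zc|)%N.
  pose U := [fset z * c | z in Z `\` Zc].
  have cU : (#|` U| + #|` Zc| = #|` Z|)%N.
    by rewrite card_imfset //= cardfsDS // subnK ?fsubset_leq_card.
  rewrite -cU addnA leq_add2r -cardfsUI.
  suff -> : mulset Z C `&` U = fset0.
    rewrite cardfs0 addn0; apply: fsubset_leq_card; apply/fsubsetP => t.
    rewrite in_fsetU => /orP[/imfset2P[z zZ [d dC ->]]|/imfsetP[z + ->]].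
      by apply: mulset_mem; rewrite // in_fset1U dC orbT.
    by rewrite in_fsetD => /andP[_ zZ]; apply: mulset_mem; rewrite // in_fset1U eqxx.
  apply/fsetP => t; rewrite in_fsetI inE; apply/negP => /andP[tZC /imfsetP[z + e]].
  by rewrite /= in_fsetD !inE -e tZC andbT => /andP[/negP].
(* Minimality gives [|ZX| |Zc| <= |Zc X| |Z|], which cancels the correction terms of [upper] and
   [lower]. *)
have := minZ Zc ZcZ.
nia.
Qed.

(** For each quotient [d = w / v], the map sending [z] to [(z w, z v)] embeds [Z] into the pairs of
    [ZW] with quotient [d]. *)
Lemma ruzsa_triangle (F : fieldType) (W Z : {fset F}) :
  0 \notin W -> 0 \notin Z ->
  (#|` divset W W| * #|` Z| <= #|` mulset Z W| ^ 2)%N.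
Proof.
move=> W0 Z0; rewrite -sum_fset_const -[X in (_ <= X)%N]mulnn -cardfsM.
have nz (V : {fset F}) v : 0 \notin V -> v \in V -> v != 0.
  by move=> V0; apply: contraTneq => ->.
pose E d := [fset p in mulset Z W `*` mulset Z W | p.1 / p.2 == d].
apply: (@leq_trans (\sum_(d <- divset W W) #|` E d|)).
  rewrite [X in (X <= _)%N]big_seq [X in (_ <= X)%N]big_seq.
  apply: leq_sum => _ /imfset2P[w wW [v vW ->]].
  apply: (@leq_card_in_fset _ _ (fun z => (z * w, z * v))) => [z zZ|z z' _ _ [+ _]].
    by rewrite !inE /= !mulset_mem //= -mulf_div divff ?mul1r ?(nz Z).
  by move/mulIf; apply; exact: (nz W).
apply: leq_sum_card_disjoint => [d _|d d' _ _ p].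
  by apply/fsubsetP => p; rewrite inE => /andP[].
by rewrite !inE => /andP[_ /eqP <-] /andP[_ /eqP <-].
Qed.

(** For [Z] in [X] minimizing [|ZX| / |Z|], [petridis] bounds [|ZXX|] by [|ZX| ^ 2 / |Z|], and
    [ruzsa_triangle] with [W = XX] turns this into a bound on [|XX / XX|]. *)
Lemma plunnecke_quotient (F : fieldType) (X : {fset F}) :
  0 \notin X ->
  (#|` divset (mulset X X) (mulset X X)| * #|` X| ^ 3 <= #|` mulset X X| ^ 4)%N.
Proof.
move=> X0; have [->|Xn0] := eqVneq X fset0; first by rewrite cardfs0 exp0n // muln0.
have [Z [ZX Zn0 minZ]] := fset_min_ratio (fun Y => #|` mulset Y X|) Xn0.
have Z0 : 0 \notin Z by apply: contra X0; exact: (fsubsetP ZX).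
have XX0 : 0 \notin mulset X X.
  apply/negP => /imfset2P[x xX [y yX /esym/eqP]]; rewrite mulf_eq0.
  by case/orP => /eqP e; move: X0; rewrite -e ?xX ?yX.
have H1 : (#|` mulset (mulset Z X) X| * #|` Z| <= #|` mulset Z X| * #|` mulset Z X|)%N.
  apply: petridis X0 _ => Y YZ.
  have [->|Y0] := eqVneq Y fset0; first by rewrite cardfs0 muln0.
  by apply: minZ => //; exact: fsubset_trans ZX.
have H2 := minZ X (fsubset_refl X) Xn0.
have := ruzsa_triangle XX0 Z0; rewrite mulsetA.
have cZ : (0 < #|` Z|)%N by rewrite cardfs_gt0.
have cX : (0 < #|` X|)%N by rewrite cardfs_gt0.
have cZX := fsubset_leq_card ZX.
move: H1 H2 cZ cX cZX; move: #|` Z| #|` X| #|` mulset X X| => z x xx.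
move: #|` mulset Z X| #|` mulset (mulset Z X) X| #|` divset _ _| => zx zxx d.
move=> H1 H2 z0 x0 zx_le H3.
(* The factor [z ^ 3] clears denominators and is cancelled below; the remaining [z] is then bounded
   by [x]. *)
have H4 : (d * x ^ 4 * z ^ 3 <= xx ^ 4 * z * z ^ 3)%N.
  apply: (@leq_trans ((zxx * z) ^ 2 * x ^ 4)).
    have -> : (d * x ^ 4 * z ^ 3 = (d * z) * (z ^ 2 * x ^ 4))%N by rewrite !expnS; lia.
    by rewrite expnMn -[X in (_ <= X)%N]mulnA leq_mul2r H3 orbT.
  apply: (@leq_trans ((zx * x) ^ 4)).
    rewrite (expnMn zx) leq_mul2r -[(zx ^ 4)%N]/(zx ^ (2 * 2))%N expnM leq_exp2r //.
    by rewrite -(mulnn zx) H1 orbT.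
  apply: (@leq_trans ((xx * z) ^ 4)); first by rewrite leq_exp2r.
  by rewrite expnMn -mulnA -expnS.
move: H4; rewrite leq_pmul2r ?expn_gt0 ?z0 // => H4.
by rewrite -(leq_pmul2r x0) -mulnA -expnSr (leq_trans H4) // leq_mul2l zx_le orbT.
Qed.

(** * Conclusion *)

Lemma sumsetS (R : realType) (A B : {fset R}) :
  A `<=` B -> (#|` sumset A| <= #|` sumset B|)%N.
Proof.
move=> /fsubsetP AB; apply: fsubset_leq_card; apply/fsubsetP => _ /imfset2P[x xA [y yA ->]].
by apply: in_imfset2; exact: AB.
Qed.

(** [B] is the larger of the positive part and the negated negative part; signs cancel in products
    of four. The extra 1 accounts for zero. *)
Lemma positive_half (R : realType) (A : {fset R}) :
  exists B : {fset R}, [/\ {in B, forall x, 0 < x},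
    (#|` B| <= #|` A|)%N, (#|` A| <= (2 * #|` B|).+1)%N,
    (#|` sumset B| <= #|` sumset A|)%N &
    (#|` mulset (mulset B B) (mulset B B)| <= #|` prodset4 A|)%N].
Proof.
pose P := [fset x in A | 0 < x]; pose N := [fset x in A | x < 0].
have PA : P `<=` A by apply/fsubsetP => x; rewrite inE => /andP[].
have NA : N `<=` A by apply/fsubsetP => x; rewrite inE => /andP[].
have cA : (#|` A| <= #|` P| + #|` N| + 1)%N.
  rewrite -(cardfs1 (0 : R)).
  apply: (@leq_trans #|` P `|` N `|` [fset 0]|).
    apply: fsubset_leq_card; apply/fsubsetP => x xA.
    by rewrite !inE xA /=; case: (ltgtP 0 x).
  apply: leq_trans (leq_card_fsetU _ _) _.
  by rewrite leq_add2r; exact: (leq_card_fsetU P N).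
have prodS (B : {fset R}) (e : R) : e ^+ 4 = 1 -> {in B, forall x, e * x \in A} ->
    (#|` mulset (mulset B B) (mulset B B)| <= #|` prodset4 A|)%N.
  move=> e4 BA; apply: fsubset_leq_card; apply/fsubsetP => t.
  move=> /imfset2P[_ /imfset2P[a aB [b bB ->]] [_ /imfset2P[c cB [d dB ->]] ->]].
  apply/imfsetP; exists (e * a, e * b, e * c, e * d); first by rewrite /= !inE /= !BA.
  by rewrite /= -[LHS]mul1r -e4; ring.
have [NP|/ltnW PN] := leqP #|` N| #|` P|.
  exists P; split; [| | |exact: sumsetS|].
  - by move=> x; rewrite inE => /andP[].
  - exact: fsubset_leq_card.
  - by lia.
  - by apply: (prodS _ 1); rewrite ?expr1n // => x xP; rewrite mul1r (fsubsetP PA).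
pose M := [fset - x | x in N].
have MN x : x \in M -> - x \in N by move=> /imfsetP[y yN ->]; rewrite opprK.
exists M; split.
- by move=> x /MN; rewrite inE => /andP[_]; rewrite oppr_lt0.
- by rewrite card_imfset /=; [exact: fsubset_leq_card|exact: oppr_inj].
- rewrite card_imfset /=; last exact: oppr_inj.
  by apply: leq_trans cA _; rewrite mul2n -addnn addn1 ltnS leq_add2r.
- apply: leq_trans (sumsetS NA); apply: (@leq_card_in_fset _ _ -%R) => [|x y _ _];
    last exact: oppr_inj.
  move=> _ /imfset2P[x /MN xN [y /MN yN ->]]; rewrite opprD; exact: in_imfset2.
- apply: (prodS _ (-1)); first by ring.
  by move=> x /MN /(fsubsetP NA); rewrite mulN1r.
Qed.

(** The exponent comes from [m ^ 9 = m ^ 3 (m ^ 2) ^ 3]: the first factor is bounded through the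
    [k ^ 3] quotients, the second through [solymosi]. *)
Lemma few_sums_many_products_pos :
  exists C : nat, forall (R : realType) (B : {fset R}) (K J : nat),
    {in B, forall x, 0 < x} -> (0 < K)%N -> (C * K ^ 8 <= #|` B|)%N ->
    (#|` sumset B| <= K * #|` B|)%N -> (#|` B| < 2 ^ J)%N ->
    (#|` B| ^ 9 <= (C * J * K ^ 10) ^ 3 *
                   #|` mulset (mulset B B) (mulset B B)| ^ 4)%N.
Proof.
(* An opaque constant, lest unary numerals get evaluated. *)
have [a aE] : exists a, a = (10 ^ 4)%N by exists (10 ^ 4)%N.
have a0 : (0 < a)%N by rewrite aE.
exists (48 * a)%N => R B K J B0 K0 mC sK mJ.
have [|h [B' [h0 B'B B'h hB' cB']]] := @popular_gap R B K _ sK.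
  have K8 : (0 < K ^ 8)%N by rewrite expn_gt0 K0.
  nia.
have sK' : (#|` sumset B'| <= 10 * K ^ 3 * #|` B'|)%N.
  apply: leq_trans (sumsetS B'B) _; apply: leq_trans sK _.
  apply: leq_trans (leq_mul (leqnn K) cB') _.
  by rewrite !expnS expn0; lia.
have [|g [D [g0 DB' Dg gD cD]]] := @popular_gap R B' (10 * K ^ 3) _ sK'.
  have K28 : (K ^ 2 <= K ^ 8)%N by rewrite leq_pexp2l.
  have K8 : (0 < K ^ 2)%N by rewrite expn_gt0 K0.
  rewrite leqNgt; apply/negP => B'4; nia.
(* The two losses multiply to [10 K ^ 2 * 10 (10 K ^ 3) ^ 2 = 10 ^ 4 K ^ 8]. *)
have cD' : (#|` B| <= a * K ^ 8 * #|` D|)%N.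
  apply: leq_trans cB' _; apply: leq_trans (leq_mul (leqnn _) cD) _.
  by rewrite aE !expnS expn0; lia.
pose k := (#|` D| %/ 3)%N.
have ck : (#|` B| <= 6 * a * K ^ 8 * k)%N.
  have cD48 : (48 <= #|` D|)%N.
    have aK : (0 < a * K ^ 8)%N by rewrite muln_gt0 a0 expn_gt0 K0.
    by rewrite -(leq_pmul2l aK) (leq_trans _ cD') // (leq_trans _ mC) // mulnC mulnA.
  have Dk : (#|` D| <= 6 * k)%N.
    by have := divn_eq #|` D| 3; have := ltn_pmod #|` D| (isT : (0 < 3)%N); rewrite -/k; lia.
  apply: leq_trans cD' _; apply: leq_trans (leq_mul (leqnn _) Dk) _.
  by rewrite mulnA (mulnC _ 6) mulnA.
have DB := fsubset_trans DB' B'B.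
have quo : (k ^ 3 <= #|` divset (mulset (mulset B B) (mulset B B))
                       (mulset (mulset B B) (mulset B B))|)%N.
  apply: (leq_cube_quotient g0 h0 B0 DB) => [x xD|x y xD yD|//|].
  (* The point [x + g] lies in [B'], so its translate by [h] lies in [B]. *)
  - have xB' := fsubsetP DB' _ xD; split; last by apply: B'h; exact: Dg.
      by apply: (fsubsetP B'B); exact: Dg.
    exact: B'h.
  - by apply: hB'; apply: (fsubsetP DB').
  - by rewrite mulnC leq_trunc_div.
have X0 : 0 \notin mulset B B.
  apply/negP => /imfset2P[x /B0 x0 [y /B0 y0 /eqP]].
  by rewrite eq_sym gt_eqF // mulr_gt0.
have := plunnecke_quotient X0; have := solymosi B0 mJ.
move: quo mC sK ck; move: (#|` divset _ _|) (#|` mulset (mulset B B) _|) => T P.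
move: (#|` mulset B B|) (#|` B|) (#|` sumset B|) => x m s kT mC sK ck sol plu.
have m0 : (0 < m)%N by rewrite (leq_trans _ mC) // muln_gt0 muln_gt0 a0 expn_gt0 K0.
have sol' : (m ^ 2 <= 8 * J * K ^ 2 * x)%N.
  have m2 : (0 < m ^ 2)%N by rewrite expn_gt0 m0.
  rewrite -(leq_pmul2r m2) -expnD (leq_trans sol) //.
  apply: (@leq_trans (x * (8 * J * (K * m) ^ 2))); last by rewrite !expnS expn0; lia.
  by rewrite !leq_mul2l leq_exp2r // sK !orbT.
apply: (@leq_trans ((6 * a * K ^ 8 * k) ^ 3 * (8 * J * K ^ 2 * x) ^ 3)).
  by rewrite -[(m ^ 9)%N]/(m ^ (3 + 2 * 3))%N expnD expnM leq_mul // leq_exp2r.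
apply: (@leq_trans ((48 * a * J * K ^ 10) ^ 3 * (T * x ^ 3))); last first.
  by rewrite leq_mul2l plu orbT.
apply: (@leq_trans ((48 * a * J * K ^ 10) ^ 3 * (k ^ 3 * x ^ 3))); last first.
  by rewrite leq_mul2l leq_mul2r kT !orbT.
rewrite -!expnMn leq_exp2r //.
by rewrite !expnS expn0; lia.
Qed.

(** Substituting [J = a q], [K = b q] and [c q m ^ 2] products gives a constant times
    [q ^ (33 + 4) m ^ 8]. One more power of [q] absorbs the constant, hence 38. *)
Lemma exponent_gap (C a b c e : nat) : (38 <= e)%N ->
  exists2 Q : nat, (0 < Q)%N & forall q m : nat, (Q <= q)%N -> (q ^ e <= 3 * m)%N ->
    (C * (b * q) ^ 8 <= m)%N /\
    ((C * (a * q) * (b * q) ^ 10) ^ 3 * (c * q * m ^ 2) ^ 4 < m ^ 9)%N.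
Proof.
move=> e38.
have collect q m : ((C * (a * q) * (b * q) ^ 10) ^ 3 * (c * q * m ^ 2) ^ 4 =
    (C * a * b ^ 10) ^ 3 * c ^ 4 * q ^ 37 * m ^ 8)%N.
  by rewrite !expnS !expn0; ring.
have lt_pow d i q m : (3 * d < q)%N -> (i < 38)%N -> (q ^ e <= 3 * m)%N ->
    (d * q ^ i < m)%N.
  move=> dq i38 qm; have q0 : (0 < q)%N := leq_ltn_trans (leq0n _) dq.
  rewrite -(ltn_pmul2l (isT : (0 < 3)%N)) mulnA (leq_trans _ qm) //.
  apply: (@leq_trans (q ^ i.+1)); last by rewrite leq_pexp2l // (leq_trans i38).
  by rewrite expnS ltn_pmul2r ?expn_gt0 ?q0.
exists (3 * (C * b ^ 8) + 3 * ((C * a * b ^ 10) ^ 3 * c ^ 4)).+1 => // q m.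
move: (_ * c ^ 4)%N collect => E collect Qq qm.
have [Dq Eq] : (3 * (C * b ^ 8) < q)%N /\ (3 * E < q)%N.
  by move: (C * b ^ 8)%N Qq => D Qq; split; lia.
split; first by rewrite expnMn mulnA; apply/ltnW/lt_pow.
have H := lt_pow _ 37%N _ _ Eq isT qm.
by rewrite collect (expnS m 8) ltn_pmul2r // expn_gt0 (leq_ltn_trans _ H).
Qed.

Theorem theorem2p2 (R : realType) :
  exists c1 c2 : R, 0 < c1 /\ 0 < c2 /\
    exists N : nat, forall A : {fset R},
      (N <= #|` A|)%N ->
      (#|` sumset A|%:R : R) <= #|` A|%:R `^ (1 + c1) ->
      #|` A|%:R `^ (2 + c2) <= (#|` prodset4 A|%:R : R).
Proof.
have [C many] := few_sums_many_products_pos.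
(* An opaque exponent, lest powers get unfolded. *)
have [e e38] : exists e, (38 <= e)%N by exists 38%N.
have e0 : (0 < e)%N := leq_ltn_trans (leq0n _) e38.
(* With [n <= 3 m] and [q + 1 <= 2 q]: sums are at most [3 m * 2 q = 6 q m], products at most
   [(3 m) ^ 2 * 2 q = 18 q m ^ 2]. Also [n < (q + 1) ^ e <= 2 ^ (e q)], so [J = e q]. *)
have [Q Q0 gap] := exponent_gap C e 6 18 e38.
pose c : R := e%:R^-1; have c0 : 0 < c by rewrite invr_gt0 ltr0n.
exists c, c; split=> //; split=> //; exists (3 * Q ^ e)%N => A QA sA.
set n := #|` A| in QA sA *.
have n3 : (3 <= n)%N by rewrite (leq_trans _ QA) // leq_pmulr // expn_gt0 Q0.
have n0 : (n%:R : R) != 0 by rewrite pnatr_eq0; lia.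
pose p : R := n%:R `^ c.
have p0 : 0 <= p := powR_ge0 _ _.
have p_n : p ^+ e = n%:R.
  by rewrite -powR_mulrn // -powRrM mulVf ?powRr1 // pnatr_eq0 -lt0n.
(* Rounding [n ^ c] down to an integer moves the rest of the argument to [nat]. *)
pose q := Num.truncn p.
have /andP[qp pq] : q%:R <= p < q.+1%:R by exact: truncn_itv.
have Qp : Q%:R <= p.
  rewrite -(@ler_pXn2r _ e) ?nnegrE // p_n -natrX ler_nat.
  by apply: leq_trans QA; exact: leq_pmull.
have Qq : (Q <= q)%N by rewrite -ltnS -(ltr_nat R) (le_lt_trans Qp).
have qn : (q ^ e <= n)%N.
  by rewrite -(ler_nat R) natrX -p_n ler_pXn2r ?nnegrE.
have nq : (n < q.+1 ^ e)%N.
  by rewrite -(ltr_nat R) natrX -p_n ltr_pXn2r ?nnegrE.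
have q0 : (0 < q)%N := leq_trans Q0 Qq.
have powE (k : nat) : n%:R `^ (k%:R + c) = n%:R ^+ k * p.
  by rewrite powRD ?n0 ?implybT // powR_mulrn.
have [B [B0 BA AB sB prodB]] := positive_half A.
have nm : (n <= 3 * #|` B|)%N by move: AB n3; rewrite -/n; lia.
have sn : (#|` sumset A| <= n * q.+1)%N.
  by rewrite -(ler_nat R) (le_trans sA) // (powE 1%N) natrM ler_wpM2l // ltW.
rewrite leNgt (powE 2%N); apply/negP => few.
have {}few : (#|` prodset4 A| < n ^ 2 * q.+1)%N.
  by rewrite -(ltr_nat R) (lt_le_trans few) // natrM natrX ler_wpM2l ?exprn_ge0 // ltW.
have [mC gap_m] := gap q #|` B| Qq (leq_trans qn nm).
have q2 : (q.+1 <= 2 * q)%N by lia.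
have sK : (#|` sumset B| <= 6 * q * #|` B|)%N.
  apply: leq_trans sB _; apply: leq_trans sn _.
  by apply: leq_trans (leq_mul nm q2) _; lia.
have mJ : (#|` B| < 2 ^ (e * q))%N.
  apply: leq_ltn_trans BA _; apply: leq_trans nq _.
  by rewrite [(e * q)%N]mulnC expnM (leq_exp2r _ _ e0) (ltn_expl q (isT : (1 < 2)%N)).
have P_le : (#|` mulset (mulset B B) (mulset B B)| <= 18 * q * #|` B| ^ 2)%N.
  apply: leq_trans prodB _; apply: leq_trans (ltnW few) _.
  apply: (@leq_trans ((3 * #|` B|) ^ 2 * (2 * q))%N); first by rewrite leq_mul // leq_exp2r.
  by rewrite expnMn; lia.
have K0 : (0 < 6 * q)%N by rewrite muln_gt0.
have := many R B _ _ B0 K0 mC sK mJ.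
rewrite leqNgt => /negP; apply; apply: leq_ltn_trans gap_m.
by rewrite leq_mul2l leq_exp2r // P_le orbT.
Qed.
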